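(* Let $(W,G,\mathcal{J},\mathcal{J}')$ be a linear generalized Hermitian space (with $\mathcal J'=H\circ\mathcal J$) and let $\iota_*:V\subseteq W$ be a bicomplex subspace, i.e. $J_+(V)=V$ and $J_-(V)=V$. Then $V$ is a generalized complex subspace of both $(W,\mathcal{J})$ and $(W,\mathcal{J}')$. Moreover, the pair of generalized complex structures $\tilde{\mathcal{J}},\tilde{\mathcal{J}}'$ induced on $V$ by $\mathcal J,\mathcal J'$ coincides with the pair of generalized complex structures of the induced generalized Hermitian structure of $V$, the one defined by the spaces $\overleftarrow{\iota}^*L_\pm$.
   Context: For a finite-dimensional real vector space $W$ put $\mathbf{W}=W\oplus W^*$ with $g((X,\alpha),(Y,\mu))=\frac12(\alpha(Y)+\mu(X))$; the superscript $c$ denotes complexification, and tensors and maps are extended complex-linearly. A linear generalized complex structure on $W$ is $\mathcal{J}\in\mathrm{End}(\mathbf W)$, $\mathcal{J}^2=-\mathrm{Id}$, $g$-skew-symmetric; it is equivalent to its $i$-eigenspace $L$, a maximal $g$-isotropic subspace of $\mathbf W^c$ with $L\cap\bar L=0$. A generalized (Euclidean) metric on $W$ is a Euclidean metric $G$ on $\mathbf W$ for which there is a decomposition $\mathbf{W}=W_+\oplus W_-$ with $W_\pm$ maximal $g$-positive, respectively $g$-negative, $W_+\perp_g W_-$, $W_+\perp_G W_-$, $G|_{W_\pm}=\pm2g|_{W_\pm}$; $H$ is the endomorphism equal to $\pm\mathrm{Id}$ on $W_\pm$. One has $W_\pm=\{(X,\flat_{\psi\pm\gamma}X): X\in W\}$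 for a unique pair $(\gamma,\psi)$, $\gamma$ a positive definite metric and $\psi\in\wedge^2W^*$, where $\flat_\theta X=\theta(X,\cdot)$; $\tau_\pm X=(X,\flat_{\psi\pm\gamma}X)$. A generalized Hermitian structure $(G,\mathcal{J})$ on $W$ is a generalized metric $G$ and a generalized complex structure $\mathcal J$ commuting with $H$; then $\mathcal{J}'=H\circ\mathcal{J}$ is a second generalized complex structure. With $L$ the $i$-eigenspace of $\mathcal J$, put $L_\pm=L\cap W_\pm^c$. The structure is equivalent to the decomposition $\mathbf{W}^c=L_+\oplus L_-\oplus\bar L_+\oplus\bar L_-$ such that (i) $L_+\oplus L_-$ and $L_+\oplus\bar L_-$ are Dirac (maximal $g$-isotropic) subspaces, and (ii) $L_+\oplus\bar L_+$ and $L_-\oplus\bar L_-$ are the complexifications of the $\pm1$-eigenspaces of the product structure $H$ of a generalized metric; the spaces in (i) are the $i$-eigenspaces of the two generalized complex structures $\mathcal J$, $\mathcal J'$ of the generalized Hermitian structure. The projections to $W$ of $\mathcal J|_{W_\pm}$ are the $\gamma$-compatible complex structures $J_\pm=pr_W\circ\mathcal{J}\circ\tau_\pm$ on $W$. For a linear map $f_*:V\to W$, the pullback of $U\subseteq\mathbf{W}^c$ is $\overleftarrow f^*U=\{(X,f^*\eta):(f_*X,\eta)\in U\}$. A subspace $\iota_*:V\subseteq W$ is a generalized complex subspace of $(W,\mathcal J)$ if $\overleftarrow\iota^*L$ is the $i$-eigenspace of a linear generalized complex structure $\tilde{\mathcal J}$ on $V$ (equivalently $\overleftarrow\iota^*L\cap\overleftarrow\iota^*\bar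 L=0$); $\tilde{\mathcal J}$ is the structure induced by $\mathcal J$. $V$ is a generalized Hermitian subspace if $\overleftarrow\iota^*L_\pm$ define a generalized Hermitian structure on $V$ (i.e. they and their conjugates decompose $\mathbf V^c$ with the analogues of (i), (ii)), called the induced structure; for a bicomplex subspace this induced generalized Hermitian structure exists. *)

(* Defs.v *)
From HB Require Import structures.
From mathcomp Require Import all_boot all_order all_algebra.
From mathcomp Require Import reals.
From mathcomp Require Import complex.
From mathcomp Require Import ring lra.

Set Implicit Arguments.
Unset Strict Implicit.
Unset Printing Implicit Defensive.

Import Order.TTheory GRing.Theory Num.Theory.
Local Open Scope ring_scope.
Local Open Scope complex_scope.

Definition maximal_vs (K : fieldType) (E : vectType K)
    (P : {vspace E} -> Prop) (U : {vspace E}) : Prop :=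
  P U /\ forall U', P U' -> (U <= U')%VS -> U' = U.

Notation dual W := 'Hom(W, _^o).

Section LinearExtras.
Variables (K : fieldType) (A B C : vectType K).

Definition pair_fun (f : 'Hom(A, B)) (g : 'Hom(A, C)) (x : A) : B * C :=
  (f x, g x).
Fact pair_fun_linear f g : linear (pair_fun f g).
Proof. by move=> k x y; rewrite /pair_fun !linearP. Qed.
HB.instance Definition _ f g := GRing.isLinear.Build K A (B * C)%type _ _
  (pair_fun_linear f g).
Definition pair_lfun f g : 'Hom(A, (B * C)%type) := linfun (pair_fun f g).
Lemma pair_lfunE f g x : pair_lfun f g x = (f x, g x).
Proof. by rewrite lfunE. Qed.

Definition fst_lfun : 'Hom((A * B)%type, A) := linfun fst.
Definition snd_lfun : 'Hom((A * B)%type, B) := linfun snd.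
Lemma fst_lfunE x : fst_lfun x = x.1. Proof. by rewrite lfunE. Qed.
Lemma snd_lfunE x : snd_lfun x = x.2. Proof. by rewrite lfunE. Qed.

Definition precomp (f : 'Hom(A, B)) (eta : dual B) : dual A := (eta \o f)%VF.
Fact precomp_linear f : linear (precomp f).
Proof.
by move=> k x y; apply/lfunP=> z; rewrite !(comp_lfunE, add_lfunE, scale_lfunE).
Qed.
HB.instance Definition _ f := GRing.isLinear.Build K (dual B) (dual A) _ _
  (precomp_linear f).
Definition dual_lfun f : 'Hom(dual B, dual A) := linfun (precomp f).
Lemma dual_lfunE f eta x : dual_lfun f eta x = eta (f x).
Proof. by rewrite lfunE comp_lfunE. Qed.
End LinearExtras.
Arguments fst_lfun {K A B}.
Arguments snd_lfun {K A B}.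

(* (x, y) : cvec V stands for x + i y. *)
Definition cvec (R : realType) (V : vectType R) : Type := (V * V)%type.

Section Complexification.
Variables (R : realType) (V : vectType R).

Lemma cvec_eq (z z' : cvec V) : z.1 = z'.1 -> z.2 = z'.2 -> z = z'.
Proof. by case: z z' => [? ?] [? ?] /= -> ->. Qed.

HB.instance Definition _ := GRing.Zmodule.on (cvec V).

Definition cscale (c : R[i]) (z : cvec V) : cvec V :=
  (complex.Re c *: z.1 - complex.Im c *: z.2,
   complex.Re c *: z.2 + complex.Im c *: z.1).

Fact cscaleA a b z : cscale a (cscale b z) = cscale (a * b) z.
Proof.
case: a b z => [a1 a2] [b1 b2] [x y]; rewrite /cscale /=.
rewrite !(scalerBr, scalerDr, scalerBl, scalerDl, scalerA).
apply: cvec_eq => /=.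
  by rewrite !opprD !addrA addrAC; congr (_ + _); rewrite addrAC.
by rewrite -!addrA; congr (_ + _); rewrite [RHS]addrC addrA.
Qed.
Fact cscale1 : left_id 1 cscale.
Proof. by case=> x y; rewrite /cscale /= !scale1r !scale0r subr0 addr0. Qed.
Fact cscaleDr : right_distributive cscale +%R.
Proof.
move=> c [x y] [x' y']; rewrite /cscale /= !scalerDr.
by apply: cvec_eq => /=; rewrite ?opprD addrACA.
Qed.
Fact cscaleDl z : {morph cscale^~ z : a b / a + b}.
Proof.
case: z => x y [a1 a2] [b1 b2]; rewrite /cscale /= !scalerDl.
by apply: cvec_eq => /=; rewrite ?opprD addrACA.
Qed.
HB.instance Definition _ := GRing.Zmodule_isLmodule.Build R[i] (cvec V)
  cscaleA cscale1 cscaleDr cscaleDl.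

Let e := vbasis {:V}.
Definition cvec2row (z : cvec V) : 'rV[R[i]]_(\dim {:V}) :=
  \row_j (coord e j z.1 +i* coord e j z.2).
Definition row2cvec (r : 'rV[R[i]]_(\dim {:V})) : cvec V :=
  (\sum_j complex.Re (r 0 j) *: e`_j, \sum_j complex.Im (r 0 j) *: e`_j).
Fact cvec_vect : Vector.axiom (\dim {:V}) (cvec V).
Proof.
exists cvec2row => [c z z'|].
  apply/rowP=> j; rewrite !mxE /= !(linearD, linearB) /= ?linearN !linearZ /=.
  by case: c => a b.
exists row2cvec => [z|r].
  by apply: cvec_eq; rewrite /= [RHS](coord_vbasis (memvf _));
    apply: eq_bigr => j _; rewrite mxE.
apply/rowP=> j; rewrite !mxE /= !coord_sum_free ?(basis_free (vbasisP _)) //.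
by case: (r 0 j).
Qed.
HB.instance Definition _ := Lmodule_hasFinDim.Build R[i] (cvec V) cvec_vect.

Definition cconj (z : cvec V) : cvec V := (z.1, - z.2).

(* cconj is antilinear, so the conjugate subspace is built from a basis. *)
Definition conjv (U : {vspace cvec V}) : {vspace cvec V} :=
  <<map cconj (vbasis U)>>%VS.

Lemma cconjK : involutive cconj.
Proof. by case=> x y; rewrite /cconj /= opprK. Qed.
Lemma cconjD : {morph cconj : z z' / z + z'}.
Proof. by move=> z z'; rewrite /cconj /= opprD. Qed.
Lemma cconjZ c z : cconj (c *: z) = (complex.Re c -i* complex.Im c) *: cconj z.
Proof.
rewrite /cconj; apply: cvec_eq => /=.
  by rewrite scalerN scaleNr opprK.
by rewrite opprD scalerN scaleNr.
Qed.
Lemma memv_conj U z : (z \in conjv U) = (cconj z \in U).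
Proof.
have conj0: cconj 0 = 0 by rewrite /cconj /= oppr0.
have sub (s : seq (cvec V)) x : x \in <<s>>%VS -> cconj x \in <<map cconj s>>%VS.
  move=> xs; rewrite (coord_span (X := in_tuple s) xs).
  rewrite (big_morph _ cconjD conj0); apply: rpred_sum => j _.
  by rewrite cconjZ; apply/rpredZ/memv_span/map_f/mem_nth.
apply/idP/idP => [/sub|zU].
  by rewrite (mapK cconjK) (span_basis (vbasisP U)).
by rewrite -[z]cconjK; apply: sub; rewrite (span_basis (vbasisP U)).
Qed.

Definition rvec (x : V) : cvec V := (x, 0).

Definition cplxv (U : {vspace V}) : {vspace cvec V} :=
  <<map rvec (vbasis U)>>%VS.

Lemma mem_cplxv U z : (z \in cplxv U) = (z.1 \in U) && (z.2 \in U).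
Proof.
apply/idP/andP => [zU|[]].
  rewrite (coord_span (X := in_tuple _) zU) /=.
  set P := fun w : cvec V => w.1 \in U /\ w.2 \in U.
  apply: (big_ind P) => [|u w [u1 u2] [w1 w2]|j _]; rewrite /P.
  - by rewrite !mem0v.
  - by rewrite !memvD.
  set b := _`_j; have: b \in map rvec (vbasis U) by exact: mem_nth.
  case/mapP=> x /vbasis_mem xU ->.
  by rewrite /= !(scaler0, subr0, add0r) !memvZ.
have re x : x \in U -> rvec x \in cplxv U.
  move=> xU; rewrite (coord_vbasis xU).
  have rD : {morph rvec : x y / x + y}.
    by move=> a b; apply: cvec_eq; rewrite /= ?addr0.
  rewrite (big_morph _ rD (erefl _)); apply: rpred_sum => j _.
  have -> k y : rvec (k *: y) = k%:C *: rvec y.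
    by apply: cvec_eq; rewrite /= !scale0r ?scaler0 ?subr0 ?addr0.
  by apply/rpredZ/memv_span/map_f/mem_nth; rewrite size_tuple.
move=> z1 z2; have -> : z = rvec z.1 + 'i *: rvec z.2.
  by apply: cvec_eq; rewrite /= !(scale0r, scaler0, scale1r, subr0, addr0, add0r).
by rewrite memvD ?memvZ ?re.
Qed.
End Complexification.

Section ComplexifiedMap.
Variables (R : realType) (A B : vectType R) (f : 'Hom(A, B)).

Definition cmap (z : cvec A) : cvec B := (f z.1, f z.2).
Fact cmap_linear : linear cmap.
Proof.
by move=> c x y; apply: cvec_eq; rewrite /= !linearD ?linearB /= ?linearN !linearZ.
Qed.
HB.instance Definition _ := GRing.isLinear.Build R[i] (cvec A) (cvec B) _ _
  cmap_linear.
Definition cplx_lfun : 'Hom(cvec A, cvec B) := linfun cmap.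
Lemma cplx_lfunE z : cplx_lfun z = (f z.1, f z.2).
Proof. by rewrite lfunE. Qed.
End ComplexifiedMap.

(* A bilinear form T on E is represented by its flat map x |-> T x. *)
Section Forms.
Variables (R : realType) (E : vectType R).

Definition form_skew (T : 'Hom(E, dual E)) := forall x y, T x y = - T y x.
Definition euclidean (T : 'Hom(E, dual E)) :=
  (forall x y, T x y = T y x) /\ forall x, x != 0 -> 0 < T x x.
End Forms.

(* W + W^*, with g given by gpair and its complex-bilinear extension cgpair. *)
Notation bold W := (W * dual W)%type.

Section GeneralizedGeometry.
Variables (R : realType) (W : vectType R).
Implicit Types (J : 'End(bold W)) (U : {vspace bold W}).
Implicit Types (L : {vspace cvec (bold W)}) (theta : 'Hom(W, dual W)).

Definition gpair (x y : bold W) : R := 2^-1 * (x.2 y.1 + y.2 x.1).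

Definition cgpair (x y : cvec (bold W)) : R[i] :=
  (gpair x.1 y.1 - gpair x.2 y.2) +i* (gpair x.1 y.2 + gpair x.2 y.1).

Definition isotropic L := {in L &, forall x y, cgpair x y = 0}.
Definition dirac L := maximal_vs isotropic L.

Definition gen_complex J :=
  (J \o J)%VF = - \1%VF /\ forall x y, gpair (J x) y = - gpair x (J y).
Definition ieig J : {vspace cvec (bold W)} := passmx.leigenspace (cplx_lfun J) 'i.

Definition g_positive U := {in U, forall x, x != 0 -> 0 < gpair x x}.
Definition g_negative U := {in U, forall x, x != 0 -> gpair x x < 0}.

(* The decomposition is determined by G, see gm_plusP and gm_minusP. *)
Record gen_metric := GenMetric {
  gm_G : 'Hom(bold W, dual (bold W));
  gm_plus : {vspace bold W};
  gm_minus : {vspace bold W};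
  gm_euclidean : euclidean gm_G;
  gm_full : (gm_plus + gm_minus)%VS = fullv;
  gm_direct : directv (gm_plus + gm_minus);
  gm_max_pos : maximal_vs g_positive gm_plus;
  gm_max_neg : maximal_vs g_negative gm_minus;
  gm_g_orth : {in gm_plus & gm_minus, forall x y, gpair x y = 0};
  gm_G_orth : {in gm_plus & gm_minus, forall x y, gm_G x y = 0};
  gm_G_plus : {in gm_plus &, forall x y, gm_G x y = 2 * gpair x y};
  gm_G_minus : {in gm_minus &, forall x y, gm_G x y = - (2 * gpair x y)} }.

Definition gm_H (M : gen_metric) : 'End(bold W) :=
  daddv_pi (gm_plus M) (gm_minus M) - daddv_pi (gm_minus M) (gm_plus M).

Definition tau theta : 'Hom(W, bold W) := pair_lfun \1%VF theta.

(* The pair exists and is unique, see gm_pair_exists and gm_pair_unique. *)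
Definition gm_pair (M : gen_metric) (gamma psi : 'Hom(W, dual W)) :=
  [/\ euclidean gamma, form_skew psi,
      gm_plus M = limg (tau (psi + gamma)) &
      gm_minus M = limg (tau (psi - gamma))].

Lemma gpairC x y : gpair x y = gpair y x.
Proof. by rewrite /gpair addrC. Qed.
Lemma gpairDr x y z : gpair x (y + z) = gpair x y + gpair x z.
Proof. by rewrite /gpair /= linearD add_lfunE -mulrDr addrACA. Qed.

Lemma gm_plusP M x :
  x \in gm_plus M <-> forall y, gm_G M x y = 2 * gpair x y.
Proof.
have sumP y : exists2 u, u \in gm_plus M & exists2 v, v \in gm_minus M & y = u + v.
  by apply/memv_addP; rewrite gm_full memvf.
split=> [xp y|eqG].
  have [u up [v vm ->]] := sumP y.
  by rewrite linearD /= gpairDr (gm_G_plus xp up) (gm_G_orth xp vm)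
    (gm_g_orth xp vm) !addr0.
have [u up [v vm xE]] := sumP x; have [Gs _] := gm_euclidean M.
have := eqG v; rewrite Gs gpairC xE linearD /= gpairDr (gm_G_minus vm vm).
rewrite Gs (gm_G_orth up vm) [gpair v u]gpairC (gm_g_orth up vm) !add0r => vv.
suff v0: v = 0 by rewrite v0 addr0.
apply/eqP; apply: contraT => /((gm_max_neg M).1 v vm); lra.
Qed.

Lemma gm_minusP M x :
  x \in gm_minus M <-> forall y, gm_G M x y = - (2 * gpair x y).
Proof.
have sumP y : exists2 u, u \in gm_plus M & exists2 v, v \in gm_minus M & y = u + v.
  by apply/memv_addP; rewrite gm_full memvf.
have [Gs _] := gm_euclidean M; split=> [xm y|eqG].
  have [u up [v vm ->]] := sumP y.
  by rewrite linearD /= gpairDr (gm_G_minus xm vm) Gs (gm_G_orth up xm)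
    [gpair x u]gpairC (gm_g_orth up xm) !add0r.
have [u up [v vm xE]] := sumP x.
have := eqG u; rewrite Gs gpairC xE linearD /= gpairDr (gm_G_plus up up).
rewrite (gm_G_orth up vm) (gm_g_orth up vm) !addr0 => uu.
suff u0: u = 0 by rewrite u0 add0r.
apply/eqP; apply: contraT => /((gm_max_pos M).1 u up); lra.
Qed.

Lemma tauE theta X : tau theta X = (X, theta X).
Proof. by rewrite pair_lfunE id_lfunE. Qed.

Lemma mem_graph theta x : (x \in limg (tau theta)) = (x.2 == theta x.1).
Proof.
apply/memv_imgP/eqP => [[X _ ->]|xE]; first by rewrite tauE.
by exists x.1; rewrite ?memvf // tauE -xE -surjective_pairing.
Qed.

Lemma graph_inj theta theta' :
  limg (tau theta) = limg (tau theta') -> theta = theta'.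
Proof.
move=> eqg; apply/lfunP=> X; apply/eqP.
by have := mem_graph theta' (X, theta X); rewrite -eqg mem_graph eqxx => <-.
Qed.

Lemma graphP U : {in U, forall x, x.1 = 0 -> x = 0} ->
  (dim W <= \dim U)%N -> exists theta, U = limg (tau theta).
Proof.
move=> inj0 dimU; pose i : 'Hom(subvs_of U, bold W) := linfun vsval.
pose f := (fst_lfun \o i)%VF.
have fE u : f u = (vsval u).1 by rewrite comp_lfunE fst_lfunE lfunE.
have f_full : limg f = fullv.
  apply/eqP; rewrite eqEdim subvf limg_dim_eq ?dimvf //.
  apply/eqP; rewrite -subv0; apply/subvP => u.
  rewrite memv_cap memv_ker fE memv0 => /andP[_ /eqP/(inj0 _ (subvsP u)) u0].
  by apply/eqP/val_inj.
have sec X : (vsval (f^-1%VF X)).1 = X by rewrite -fE limg_lfunVK ?f_full ?memvf.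
exists (snd_lfun \o i \o f^-1)%VF; apply/vspaceP => x.
rewrite mem_graph !comp_lfunE snd_lfunE lfunE /=.
apply/idP/eqP => [xU|x2].
  rewrite -[x in LHS]subr0 -[0 in LHS](inj0 (x - vsval (f^-1%VF x.1))).
  - by rewrite opprB addrC subrK.
  - by rewrite memvB ?subvsP.
  - by rewrite /= sec subrr.
by rewrite [x]surjective_pairing x2 -[X in (X, _)]sec -surjective_pairing subvsP.
Qed.

Lemma gm_pair_exists M : exists gamma psi, gm_pair M gamma psi.
Proof.
have pos0 : {in gm_plus M, forall x : bold W, x.1 = 0 -> x = 0}.
  move=> x xp x0; apply/eqP; apply: contraT => /((gm_max_pos M).1 x xp).
  by rewrite /gpair x0 linear0 addr0 mulr0 ltxx.
have neg0 : {in gm_minus M, forall x : bold W, x.1 = 0 -> x = 0}.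
  move=> x xp x0; apply/eqP; apply: contraT => /((gm_max_neg M).1 x xp).
  by rewrite /gpair x0 linear0 addr0 mulr0 ltxx.
have le_dim (U : {vspace bold W}) :
    {in U, forall x : bold W, x.1 = 0 -> x = 0} -> (\dim U <= dim W)%N.
  move=> U0; rewrite -(@limg_dim_eq _ _ _ fst_lfun U).
    by rewrite -[dim W]dimvf dimvS ?subvf.
  apply/eqP; rewrite -subv0; apply/subvP => u.
  by rewrite memv_cap memv_ker fst_lfunE memv0 => /andP[/U0 u0 /eqP/u0->].
have dimE : (\dim (gm_plus M) + \dim (gm_minus M) = dim W + dim W)%N.
  have /directvP/= <- := gm_direct M.
  by rewrite gm_full dimvf -[dim (bold W)]/(dim W + dim W * 1)%N muln1.
have [lep lem] := (le_dim _ pos0, le_dim _ neg0).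
have [||tp tpE] := @graphP (gm_plus M); first exact: pos0.
  by move: lem; rewrite -(leq_add2l (\dim (gm_plus M))) dimE leq_add2r.
have [||tm tmE] := @graphP (gm_minus M); first exact: neg0.
  by move: lep; rewrite -(leq_add2r (\dim (gm_minus M))) dimE leq_add2l.
have orth X Y : tp X Y = - tm Y X.
  have := @gm_g_orth M (X, tp X) (Y, tm Y).
  rewrite tpE tmE !mem_graph /= !eqxx => /(_ isT isT); rewrite /gpair /=; lra.
exists (2^-1 *: (tp - tm)), (2^-1 *: (tp + tm)); split.
- split=> [X Y|X X0].
    rewrite !(scale_lfunE, add_lfunE, opp_lfunE) (orth Y X) (orth X Y).
    by rewrite addrC.
  rewrite !(scale_lfunE, add_lfunE, opp_lfunE) -(orth X X).
  have := (gm_max_pos M).1 (X, tp X).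
  rewrite tpE mem_graph eqxx => /(_ isT); rewrite /gpair /=; apply.
  by apply: contraNneq X0 => -[->].
- move=> X Y; rewrite !(scale_lfunE, add_lfunE) (orth Y X) (orth X Y).
  by rewrite -scalerN opprD opprK addrC.
- by rewrite tpE -scalerDr addrACA subrr addr0 -mulr2n -scaler_nat scalerA
    mulVf ?scale1r ?pnatr_eq0.
by rewrite tmE -scalerBr opprB [tp + tm]addrC addrACA subrr addr0
    -mulr2n -scaler_nat scalerA mulVf ?scale1r ?pnatr_eq0.
Qed.

Lemma gm_pair_unique M gamma psi gamma' psi' :
  gm_pair M gamma psi -> gm_pair M gamma' psi' ->
  gamma = gamma' /\ psi = psi'.
Proof.
case=> _ _ pE mE [_ _]; rewrite pE mE => /graph_inj eqp /graph_inj eqm.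
have half (x y : 'Hom(W, dual W)) : x + x = y + y -> x = y.
  by rewrite -!mulr2n -!scaler_nat => /scalerI -> //; rewrite pnatr_eq0.
split; apply: half.
  have sumE (g p : 'Hom(W, dual W)) : g + g = (p + g) - (p - g).
    by rewrite opprB [RHS]addrC addrA subrK.
  by rewrite (sumE _ psi) eqp eqm -sumE.
have sumE (g p : 'Hom(W, dual W)) : p + p = (p + g) + (p - g).
  by rewrite addrACA subrr addr0.
by rewrite (sumE gamma) eqp eqm -sumE.
Qed.

Record gen_hermitian := GenHermitian {
  gh_metric :> gen_metric;
  gh_J : 'End(bold W);
  gh_complex : gen_complex gh_J;
  gh_comm : (gh_J \o gm_H gh_metric = gm_H gh_metric \o gh_J)%VF }.

Definition gh_J' (S : gen_hermitian) : 'End(bold W) := (gm_H S \o gh_J S)%VF.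

Definition gh_Lplus (S : gen_hermitian) : {vspace cvec (bold W)} :=
  (ieig (gh_J S) :&: cplxv (gm_plus S))%VS.
Definition gh_Lminus (S : gen_hermitian) : {vspace cvec (bold W)} :=
  (ieig (gh_J S) :&: cplxv (gm_minus S))%VS.

Definition gh_Jplus (S : gen_hermitian) (gamma psi : 'Hom(W, dual W)) :=
  (fst_lfun \o gh_J S \o tau (psi + gamma))%VF.
Definition gh_Jminus (S : gen_hermitian) (gamma psi : 'Hom(W, dual W)) :=
  (fst_lfun \o gh_J S \o tau (psi - gamma))%VF.

(* Lp and Lm satisfy the decomposition conditions, and S is the generalized
   Hermitian structure they define. *)
Definition gh_defined_by (Lp Lm : {vspace cvec (bold W)}) (S : gen_hermitian) :=
  [/\ (Lp + Lm + conjv Lp + conjv Lm)%VS = fullv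
        /\ directv (Lp + Lm + conjv Lp + conjv Lm),
      dirac (Lp + Lm) /\ dirac (Lp + conjv Lm),
      (Lp + conjv Lp)%VS = cplxv (gm_plus S)
        /\ (Lm + conjv Lm)%VS = cplxv (gm_minus S) &
      ieig (gh_J S) = (Lp + Lm)%VS /\ ieig (gh_J' S) = (Lp + conjv Lm)%VS].

End GeneralizedGeometry.

Section Pullback.
Variables (R : realType) (V W : vectType R) (f : 'Hom(V, W)).

Definition push_vec : 'Hom((V * dual W)%type, bold W) :=
  pair_lfun (f \o fst_lfun)%VF snd_lfun.
Definition pull_covec : 'Hom((V * dual W)%type, bold V) :=
  pair_lfun fst_lfun (dual_lfun f \o snd_lfun)%VF.

Definition pullback (U : {vspace cvec (bold W)}) : {vspace cvec (bold V)} :=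
  (cplx_lfun pull_covec @: (cplx_lfun push_vec @^-1: U))%VS.

Lemma mem_pullback (U : {vspace cvec (bold W)}) (z : cvec (bold V)) :
  z \in pullback U <->
  exists (X : cvec V) (eta : cvec (dual W)),
    (z = ((X.1, (eta.1 \o f)%VF), (X.2, (eta.2 \o f)%VF)) :> cvec (bold V)) /\
    (((f X.1, eta.1), (f X.2, eta.2)) : cvec (bold W)) \in U.
Proof.
have pE (w : cvec (V * dual W)%type) : cplx_lfun push_vec w =
    ((f w.1.1, w.1.2), (f w.2.1, w.2.2)).
  by rewrite cplx_lfunE !pair_lfunE !comp_lfunE !fst_lfunE !snd_lfunE.
have qE (w : cvec (V * dual W)%type) : cplx_lfun pull_covec w =
    ((w.1.1, (w.1.2 \o f)%VF), (w.2.1, (w.2.2 \o f)%VF)).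
  by rewrite cplx_lfunE !pair_lfunE !comp_lfunE !fst_lfunE !snd_lfunE !lfunE.
split=> [/memv_imgP[w]|[X [eta [-> hU]]]].
  rewrite -memv_preim pE qE => hU ->.
  by exists (w.1.1, w.2.1), (w.1.2, w.2.2).
apply/memv_imgP; exists ((X.1, eta.1), (X.2, eta.2)); last by rewrite qE.
by rewrite -memv_preim pE.
Qed.
End Pullback.

Section Subspaces.
Variables (R : realType) (W : vectType R) (V : {vspace W}).

Definition incl : 'Hom(subvs_of V, W) := linfun vsval.

Definition gc_induced (J : 'End(bold W)) (Jt : 'End(bold (subvs_of V))) :=
  gen_complex Jt /\ ieig Jt = pullback incl (ieig J).
Definition gc_subspace (J : 'End(bold W)) := exists Jt, gc_induced J Jt.

Definition gh_induced (S : gen_hermitian W) (T : gen_hermitian (subvs_of V)) :=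
  gh_defined_by (pullback incl (gh_Lplus S)) (pullback incl (gh_Lminus S)) T.

(* (gamma, psi) is meant to be the pair of S, see gm_pair. *)
Definition bicomplex (S : gen_hermitian W) (gamma psi : 'Hom(W, dual W)) :=
  (gh_Jplus S gamma psi @: V)%VS = V /\ (gh_Jminus S gamma psi @: V)%VS = V.
End Subspaces.
Arguments gc_subspace {R W} V J.
Arguments gc_induced {R W} V J Jt.
Arguments gh_induced {R W} V S T.
Arguments bicomplex {R W} V S gamma psi.

(* Main.v *)
Require Import Defs.
From mathcomp Require Import all_boot all_order all_algebra.
From mathcomp Require Import reals complex.
From mathcomp Require Import lra.

(** The data of a generalized Hermitian structure on W are the same as a
    Euclidean metric gamma, a 2-form psi and two gamma-skew complex structures
    J_+ and J_-: the map tau_(+-) identifies W with W_(+-) and turns the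
    restriction of J to W_(+-) into J_(+-) (gh_J_tp, gh_J_tm).  Such data
    restrict to a subspace V stable under J_+ and J_-, and from the
    restrictions graph_gen_hermitian builds a generalized Hermitian structure T
    on V.

    For an operator with square -1 a complex vector (x, y), read x + i y, is in
    the i-eigenspace if and only if y = - J x.  Hence L_(+-) consists of the
    vectors (x, - J x) with x in W_(+-), and, since x = (X, theta X) with
    theta = psi +- gamma, such a vector is determined by X and J_(+-) X.  In
    this description the pullback to V only restricts X and theta
    (pullback_graph_eigenspace); so it turns L_+ and L_- of W into L_+ and L_-
    of T.

    The spaces L_+ and L_- of any generalized Hermitian structure satisfy the
    decomposition conditions (gh_defined_by_Lpm), so T is induced on V.

    It remains to compare the pullback of L = L_+ + L_- with the sum of the
    pullbacks.  The sum is contained in the pullback of L, which is isotropic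
    because the pullback preserves the pairing; but the sum is Dirac, that is,
    maximal isotropic.  So the two are equal, and likewise for the second
    structure, where L_- is replaced by its conjugate (gh_induced_gc).  As a
    generalized complex structure is determined by its i-eigenspace (ieig_inj),
    the induced pairs coincide. *)

Set Implicit Arguments.
Unset Strict Implicit.
Unset Printing Implicit Defensive.

Import Order.TTheory GRing.Theory Num.Theory.
Local Open Scope ring_scope.
Local Open Scope complex_scope.

(** * Linear preliminaries *)

Lemma half_double (R : realType) (V : lmodType R) (x : V) :
  2^-1 *: (x + x) = x.
Proof. by rewrite -mulr2n -scaler_nat scalerA mulVf ?scale1r ?pnatr_eq0. Qed.

Lemma opp_fixed_eq0 (R : realType) (V : lmodType R) (x : V) : x = - x -> x = 0.
Proof.
by move/eqP; rewrite -addr_eq0 -mulr2n -scaler_nat scaler_eq0 pnatr_eq0 => /eqP.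
Qed.

(** In these identities only linearity matters, so W + W^* is replaced by an
    arbitrary space E. *)
Section AbstractMaps.
Variables (K : fieldType) (E A B : vectType K).

Lemma sqr_oppE (J : 'End(E)) : (J \o J)%VF = - \1%VF <-> forall x, J (J x) = - x.
Proof.
split=> [JJ x|JJ]; first by rewrite -comp_lfunE JJ opp_lfunE id_lfunE.
by apply/lfunP=> x; rewrite comp_lfunE JJ opp_lfunE id_lfunE.
Qed.

Lemma daddv_pi_diff (U V : {vspace E}) : (U :&: V = 0)%VS ->
  {in U, forall x, (daddv_pi U V - daddv_pi V U) x = x} /\
  {in V, forall x, (daddv_pi U V - daddv_pi V U) x = - x}.
Proof.
move=> UV0; have VU0 : (V :&: U = 0)%VS by rewrite capvC.
split=> x xU; rewrite add_lfunE opp_lfunE.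
  have := daddv_pi_add UV0 (subvP (addvSl U V) _ xU).
  rewrite (daddv_pi_id UV0 xU) => /(canRL (addKr _)); rewrite addNr => ->.
  by rewrite subr0.
have := daddv_pi_add UV0 (subvP (addvSr U V) _ xU).
rewrite (daddv_pi_id VU0 xU) => /(canRL (addrK _)); rewrite subrr => ->.
by rewrite sub0r.
Qed.

Lemma add_comp_diffE (k : K) (f : 'Hom(E, A)) (h : 'Hom(E, B)) (p : 'Hom(A, B))
    (g : 'Hom(B, A)) x :
  (k *: (f + (g \o (h - (p \o f)%VF))%VF)) x = k *: (f x + g (h x - p (f x))).
Proof. by rewrite scale_lfunE add_lfunE comp_lfunE add_lfunE opp_lfunE comp_lfunE. Qed.

Lemma sub_comp_diffE (k : K) (f : 'Hom(E, A)) (h : 'Hom(E, B)) (p : 'Hom(A, B))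
    (g : 'Hom(B, A)) x :
  (k *: (f - (g \o (h - (p \o f)%VF))%VF)) x = k *: (f x - g (h x - p (f x))).
Proof.
by rewrite scale_lfunE add_lfunE opp_lfunE comp_lfunE add_lfunE opp_lfunE comp_lfunE.
Qed.

Lemma pullback_forms_sumE (k : K) (t : 'Hom(A, dual A)) (f g : 'Hom(E, A)) x y :
  (k *: ((dual_lfun f \o t \o f)%VF + (dual_lfun g \o t \o g)%VF)) x y
    = k * (t (f x) (f y) + t (g x) (g y)).
Proof.
by rewrite scale_lfunE add_lfunE !comp_lfunE scale_lfunE add_lfunE !dual_lfunE.
Qed.
End AbstractMaps.

(** * The pairing and Dirac subspaces *)

Section Pairing.
Variables (R : realType) (W : vectType R).
Implicit Types (x y z : bold W) (U L : {vspace cvec (bold W)}).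

Lemma gpairDl x y z : gpair (x + y) z = gpair x z + gpair y z.
Proof. by rewrite !(gpairC _ z) gpairDr. Qed.

Lemma gpairNr x y : gpair x (- y) = - gpair x y.
Proof. by rewrite /gpair /= linearN opp_lfunE -opprD mulrN. Qed.

Lemma gpairNl x y : gpair (- x) y = - gpair x y.
Proof. by rewrite !(gpairC _ y) gpairNr. Qed.

(** Tested against W^* with the coordinate forms of a basis, and against W. *)
Lemma gpair_nondegenerate x : (forall y, gpair x y = 0) -> x = 0.
Proof.
move=> x0; have two0 : 2^-1 != 0 :> R by rewrite invr_eq0 pnatr_eq0.
rewrite [x]surjective_pairing; congr (_, _).
  rewrite [x.1](coord_vbasis (memvf _)) big1 // => i _.
  have := x0 (0, linfun (coord (vbasis {:W}) i : W -> R^o)).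
  rewrite /gpair /= linear0 add0r lfunE /= => /eqP.
  by rewrite mulf_eq0 (negPf two0) => /eqP->; rewrite scale0r.
apply/lfunP=> Y; have := x0 (Y, 0); rewrite /gpair /= !lfunE addr0 => /eqP.
by rewrite mulf_eq0 (negPf two0) => /eqP.
Qed.

Lemma cgpairDr (x y z : cvec (bold W)) : cgpair x (y + z) = cgpair x y + cgpair x z.
Proof.
(* Only the additivity of the pairing matters. *)
rewrite /cgpair; move: (@gpairDr R W); move: (@gpair R W) => f fD.
have addE (a a' b b' c c' d d' : R) :
    (a + a' - (b + b')) +i* (c + c' + (d + d')) =
    ((a - b) +i* (c + d)) + ((a' - b') +i* (c' + d')).
  by rewrite opprD addrACA (addrACA c).
by rewrite -addE -!fD.
Qed.

Lemma isotropic_conjv L : isotropic L -> isotropic (conjv L).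
Proof.
move=> Liso x y; rewrite !memv_conj => xL yL.
have := Liso _ _ xL yL; rewrite /cgpair /cconj /= !gpairNl !gpairNr opprK.
move/eqP; rewrite eq_complex /= => /andP[/eqP re /eqP im].
by apply/eqP; rewrite eq_complex /= re eqxx -oppr_eq0 opprD im eqxx.
Qed.

(** Let a + b belong to an isotropic space containing L, with a in L and b in
    the conjugate of L.  Then b is in that space too, hence is orthogonal to L;
    it is orthogonal to the conjugate of L, which is isotropic; so b is
    orthogonal to everything and vanishes. *)
Lemma dirac_of_conjv L : isotropic L -> (L + conjv L)%VS = fullv -> dirac L.
Proof.
move=> Liso Lfull; split=> // U Uiso LU; apply/eqP; rewrite eqEsubv LU andbT.
apply/subvP=> z zU; have := memvf z; rewrite -Lfull => /memv_addP[a aL [b bL zE]].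
have bU : b \in U.
  by rewrite -[b](addKr a) -zE memvD ?memvN // (subvP LU).
suff -> : z = a by [].
suff b0 : b = 0 by rewrite zE b0 addr0.
have bperp (y : cvec (bold W)) : cgpair b y = 0.
  have := memvf y; rewrite -Lfull => /memv_addP[c cL [d dL ->]].
  rewrite cgpairDr (Uiso _ _ bU (subvP LU _ cL)).
  by rewrite (isotropic_conjv Liso bL dL) addr0.
have bpart w : gpair b.1 w = 0 /\ gpair b.2 w = 0.
  have := bperp ((w, 0) : cvec (bold W)); rewrite /cgpair /= => /eqP; rewrite eq_complex /=.
  have g0 (v : bold W) : gpair v 0 = 0 by rewrite /gpair /= linear0 lfunE addr0 mulr0.
  by rewrite !g0 subr0 add0r => /andP[/eqP -> /eqP ->].
by apply: cvec_eq; apply: gpair_nondegenerate => w; case: (bpart w).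
Qed.

End Pairing.

(** * Generalized complex structures and their eigenspaces *)

Section GeneralizedComplex.
Variables (R : realType) (W : vectType R) (J : 'End(bold W)).
Hypothesis Jgc : gen_complex J.

Lemma gen_complexK x : J (J x) = - x.
Proof. exact: (sqr_oppE J).1 Jgc.1 x. Qed.

Lemma gen_complex_skew x y : gpair (J x) y = - gpair x (J y).
Proof. exact: Jgc.2. Qed.

(** With z = x + i y the equation J z = i z reads J x = - y and J y = x; the
    second half follows from the first. *)
Lemma mem_ieig z : (z \in ieig J) = (z.2 == - J z.1).
Proof.
rewrite memv_ker add_lfunE opp_lfunE scale_lfunE id_lfunE cplx_lfunE subr_eq0.
have -> : 'i *: z = (- z.2, z.1) :> cvec (bold W).
  by apply: cvec_eq; rewrite /= !(scale0r, scale1r) ?sub0r ?add0r.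
rewrite xpair_eqE; apply/andP/eqP => [[/eqP -> _]|->]; first by rewrite opprK.
by rewrite opprK linearN /= gen_complexK opprK.
Qed.

Lemma ieig_isotropic : isotropic (ieig J).
Proof.
move=> x y; rewrite !mem_ieig => /eqP xE /eqP yE.
rewrite /cgpair xE yE !gpairNl !gpairNr !gen_complex_skew gen_complexK gpairNr !opprK.
by rewrite subrr addNr.
Qed.

Lemma ieig_full : (ieig J + conjv (ieig J))%VS = fullv.
Proof.
apply/eqP; rewrite eqEsubv subvf; apply/subvP=> z _.
(* The projections of z to the two eigenspaces are (z -+ i J z) / 2; a and b
   are their real parts. *)
pose a := 2^-1 *: (z.1 + J z.2); pose b := 2^-1 *: (z.1 - J z.2).
apply/memv_addP; exists (a, - J a); first by rewrite mem_ieig.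
exists (b, J b); first by rewrite memv_conj mem_ieig.
apply: cvec_eq => /=.
  by rewrite /a /b -scalerDr addrACA subrr addr0 half_double.
have ba : b - a = - J z.2.
  rewrite -[RHS]half_double -scalerBr; congr (_ *: _).
  by rewrite opprD addrACA subrr add0r.
by rewrite addrC -linearB ba linearN /= gen_complexK opprK.
Qed.

Lemma dirac_ieig : dirac (ieig J).
Proof. exact: dirac_of_conjv ieig_isotropic ieig_full. Qed.

Lemma ieig_conjv0 : (ieig J :&: conjv (ieig J) = 0)%VS.
Proof.
apply/eqP; rewrite -subv0; apply/subvP=> z; rewrite memv_cap memv_conj !mem_ieig.
rewrite /= memv0 eqr_opp => /andP[/eqP z2 /eqP z2']; rewrite z2' in z2.
have J0 : J z.1 = 0 by apply: opp_fixed_eq0.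
apply/eqP/cvec_eq; last by rewrite z2' J0.
by rewrite -[z.1]opprK -(gen_complexK z.1) J0 linear0 oppr0.
Qed.
End GeneralizedComplex.

(** The vector x - i J x is in the i-eigenspace for every real x, and this
    reads off J x. *)
Lemma ieig_inj (R : realType) (W : vectType R) (J J' : 'End(bold W)) :
  gen_complex J -> gen_complex J' -> ieig J = ieig J' -> J = J'.
Proof.
move=> Jgc J'gc eqL; apply/lfunP=> x; apply/eqP.
have := mem_ieig Jgc (x, - J x); rewrite eqL (mem_ieig J'gc) /= eqxx.
by rewrite eqr_opp.
Qed.

(** * The involution of a generalized metric *)

Section MetricInvolution.
Variables (R : realType) (W : vectType R) (M : gen_metric W).
Local Notation Wp := (gm_plus M).
Local Notation Wm := (gm_minus M).

Lemma gm_split (x : bold W) :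
  exists2 u, u \in Wp & exists2 v, v \in Wm & x = u + v.
Proof. by apply/memv_addP; rewrite gm_full memvf. Qed.

Lemma gm_cap0 : (Wp :&: Wm = 0)%VS.
Proof. exact/directv_addP/gm_direct. Qed.

Lemma gm_Hplus x : x \in Wp -> gm_H M x = x.
Proof. exact: (daddv_pi_diff gm_cap0).1. Qed.

Lemma gm_Hminus x : x \in Wm -> gm_H M x = - x.
Proof. exact: (daddv_pi_diff gm_cap0).2. Qed.

Lemma gm_HK x : gm_H M (gm_H M x) = x.
Proof.
have [u up [v vm ->]] := gm_split x.
by rewrite linearD /= (gm_Hplus up) (gm_Hminus vm) linearB /= (gm_Hplus up)
  (gm_Hminus vm) opprK.
Qed.

Lemma gm_Hsym x y : gpair (gm_H M x) y = gpair x (gm_H M y).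
Proof.
have [u up [v vm ->]] := gm_split x; have [a ap [b bm ->]] := gm_split y.
rewrite !linearD /= (gm_Hplus up) (gm_Hplus ap) (gm_Hminus vm) (gm_Hminus bm).
rewrite !(gpairDl, gpairDr, gpairNl, gpairNr) (gm_g_orth up bm).
by rewrite (gpairC v a) (gm_g_orth ap vm) !(addr0, oppr0, add0r).
Qed.

Lemma gm_plusH x : (x \in Wp) = (gm_H M x == x).
Proof.
apply/idP/eqP => [/gm_Hplus //|]; have [u up [v vm ->]] := gm_split x.
rewrite linearD /= (gm_Hplus up) (gm_Hminus vm) => /addrI/esym/opp_fixed_eq0->.
by rewrite addr0.
Qed.

Lemma gm_minusH x : (x \in Wm) = (gm_H M x == - x).
Proof.
apply/idP/eqP => [/gm_Hminus //|]; have [u up [v vm ->]] := gm_split x.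
rewrite linearD /= (gm_Hplus up) (gm_Hminus vm) opprD => /addIr/opp_fixed_eq0->.
by rewrite add0r.
Qed.

End MetricInvolution.

(** * The decomposition of a generalized Hermitian structure *)

Section HermitianEigenspaces.
Variables (R : realType) (W : vectType R) (S : gen_hermitian W).
Local Notation J := (gh_J S).
Local Notation Wp := (gm_plus S).
Local Notation Wm := (gm_minus S).
Let Jgc := gh_complex S.

Lemma gh_JH x : J (gm_H S x) = gm_H S (J x).
Proof. by have /lfunP/(_ x) := gh_comm S; rewrite !comp_lfunE. Qed.

Lemma gh_J_plus x : x \in Wp -> J x \in Wp.
Proof. by rewrite !gm_plusH -gh_JH => /eqP->. Qed.

Lemma gh_J_minus x : x \in Wm -> J x \in Wm.
Proof. by rewrite !gm_minusH -gh_JH => /eqP->; rewrite linearN. Qed.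

Lemma gh_J'_complex : gen_complex (gh_J' S).
Proof.
split=> [|x y].
  by apply/sqr_oppE => x; rewrite !comp_lfunE gh_JH gm_HK (gen_complexK Jgc).
by rewrite !comp_lfunE gm_Hsym (gen_complex_skew Jgc) gh_JH.
Qed.

Lemma mem_gh_Lplus z : (z \in gh_Lplus S) = (z.1 \in Wp) && (z.2 == - J z.1).
Proof.
rewrite memv_cap mem_cplxv (mem_ieig Jgc).
apply/idP/idP => [/and3P[-> -> _] //|/andP[zp /eqP z2]].
by rewrite z2 eqxx zp memvN gh_J_plus.
Qed.

Lemma mem_gh_Lminus z : (z \in gh_Lminus S) = (z.1 \in Wm) && (z.2 == - J z.1).
Proof.
rewrite memv_cap mem_cplxv (mem_ieig Jgc).
apply/idP/idP => [/and3P[-> -> _] //|/andP[zm /eqP z2]].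
by rewrite z2 eqxx zm memvN gh_J_minus.
Qed.

Lemma ieig_J_split : ieig J = (gh_Lplus S + gh_Lminus S)%VS.
Proof.
apply/eqP; rewrite eqEsubv; apply/andP; split; last by rewrite subv_add !capvSl.
apply/subvP=> z.
rewrite (mem_ieig Jgc) => /eqP z2; have [u up [v vm z1]] := gm_split S z.1.
apply/memv_addP; exists (u, - J u); first by rewrite mem_gh_Lplus up /=.
exists (v, - J v); first by rewrite mem_gh_Lminus vm /=.
by apply: cvec_eq; rewrite //= z2 z1 linearD opprD.
Qed.

Lemma Lplus_sub_J' : (gh_Lplus S <= ieig (gh_J' S))%VS.
Proof.
apply/subvP=> z; rewrite mem_gh_Lplus (mem_ieig gh_J'_complex) comp_lfunE.
by case/andP=> zp; rewrite gm_Hplus ?gh_J_plus.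
Qed.

Lemma conj_Lminus_sub_J' : (conjv (gh_Lminus S) <= ieig (gh_J' S))%VS.
Proof.
apply/subvP=> z; rewrite memv_conj mem_gh_Lminus (mem_ieig gh_J'_complex).
rewrite /= comp_lfunE => /andP[zm]; rewrite gm_Hminus ?gh_J_minus //.
by rewrite eqr_oppLR.
Qed.

Lemma ieig_J'_split : ieig (gh_J' S) = (gh_Lplus S + conjv (gh_Lminus S))%VS.
Proof.
apply/eqP; rewrite eqEsubv; apply/andP; split; last first.
  by rewrite subv_add Lplus_sub_J' conj_Lminus_sub_J'.
apply/subvP=> z; rewrite (mem_ieig gh_J'_complex) comp_lfunE => /eqP z2.
have [u up [v vm z1]] := gm_split S z.1.
apply/memv_addP; exists (u, - J u); first by rewrite mem_gh_Lplus up /=.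
exists (v, J v); first by rewrite memv_conj mem_gh_Lminus vm /=.
apply: cvec_eq; rewrite //= z2 z1 !linearD /= gm_Hplus ?gh_J_plus //.
by rewrite gm_Hminus ?gh_J_minus // opprK.
Qed.

Lemma conjvD (U V : {vspace cvec (bold W)}) :
  conjv (U + V)%VS = (conjv U + conjv V)%VS.
Proof.
apply/vspaceP=> z; rewrite memv_conj; apply/memv_addP/memv_addP.
  case=> a aU [b bV zE]; exists (cconj a); first by rewrite memv_conj cconjK.
  exists (cconj b); first by rewrite memv_conj cconjK.
  by rewrite -cconjD -zE cconjK.
case=> a; rewrite memv_conj => aU [b]; rewrite memv_conj => bV ->.
by exists (cconj a) => //; exists (cconj b) => //; rewrite cconjD.
Qed.

(** A J-stable real subspace is complexified to a J-stable complex subspace,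
    which therefore splits into its two eigenspaces. *)
Lemma cplxv_split (U : {vspace bold W}) : {in U, forall x, J x \in U} ->
  (ieig J :&: cplxv U + conjv (ieig J :&: cplxv U) = cplxv U)%VS.
Proof.
move=> JU; apply/eqP; rewrite eqEsubv subv_add capvSr /=.
apply/andP; split; apply/subvP=> z.
  rewrite memv_conj memv_cap !mem_cplxv /= => /and3P[_ -> zU].
  by rewrite -[z.2]opprK memvN.
rewrite mem_cplxv => /andP[z1U z2U].
have := memvf z; rewrite -(ieig_full Jgc) => /memv_addP[a + [b + zE]].
rewrite memv_conj !(mem_ieig Jgc) /= eqr_opp => /eqP a2 /eqP b2.
have JzE : - J z.2 = b.1 - a.1.
  rewrite zE /= a2 b2 linearD linearN /= !(gen_complexK Jgc) opprK.
  by rewrite opprD opprK addrC.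
have dbl (x : bold W) : x + x \in U -> x \in U.
  by rewrite -mulr2n -scaler_nat rpredZeq pnatr_eq0.
have bU : b.1 \in U.
  apply: dbl; have := memvD z1U (_ : - J z.2 \in U); rewrite memvN JU // JzE zE /=.
  by rewrite (addrC a.1) addrACA subrr addr0; apply.
have aU : a.1 \in U.
  by rewrite -[a.1](addrK b.1) memvB // -[a.1 + b.1]/((a + b : cvec _).1) -zE.
apply/memv_addP; exists a.
  by rewrite memv_cap mem_cplxv (mem_ieig Jgc) a2 eqxx aU memvN JU.
exists b => //; rewrite memv_conj memv_cap mem_cplxv (mem_ieig Jgc) /= b2 eqxx bU.
by rewrite memvN JU.
Qed.

Lemma Lplus_cplxv : (gh_Lplus S + conjv (gh_Lplus S) = cplxv Wp)%VS.
Proof. exact: cplxv_split gh_J_plus. Qed.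

Lemma Lminus_cplxv : (gh_Lminus S + conjv (gh_Lminus S) = cplxv Wm)%VS.
Proof. exact: cplxv_split gh_J_minus. Qed.

Lemma cplxv_cap0 : (cplxv Wp :&: cplxv Wm = 0)%VS.
Proof.
apply/eqP; rewrite -subv0; apply/subvP=> z; rewrite memv_cap !mem_cplxv memv0.
have cap0 x : x \in Wp -> x \in Wm -> x = 0.
  by move=> xp xm; apply/eqP; rewrite -memv0 -(gm_cap0 S) memv_cap xp.
by case/andP=> /andP[z1p z2p] /andP[z1m z2m]; apply/eqP/cvec_eq; apply: cap0.
Qed.

(** The four spaces are the intersections of the two eigenspaces of J with the
    complexifications of W_+ and W_-.  A relation z = a + b + c with z and b on
    the side of W_- and a, c on the side of W_+ gives z = b, and z, b lie in
    opposite eigenspaces. *)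
Lemma gh_directv :
  directv (gh_Lplus S + gh_Lminus S + conjv (gh_Lplus S) + conjv (gh_Lminus S)).
Proof.
have e1 : (gh_Lplus S :&: gh_Lminus S = 0)%VS.
  apply/eqP; rewrite -subv0 -cplxv_cap0; exact: capvS (capvSr _ _) (capvSr _ _).
have e2 : (ieig J :&: conjv (gh_Lplus S) = 0)%VS.
  apply/eqP; rewrite -subv0 -(ieig_conjv0 Jgc) ieig_J_split conjvD.
  exact/capvS/addvSl.
rewrite directv_addE directv_addE directv_addE !directv_trivial /=.
rewrite -ieig_J_split e1 e2 eqxx /= -subv0; apply/subvP=> z; rewrite memv_cap.
case/andP=> /memv_addP[w]; rewrite {1}ieig_J_split.
case/memv_addP=> a aL [b bL ->] [c cL zE] zL.
have zE' : z - b = a + c by apply: (canLR (addrK b)); rewrite zE addrAC.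
have zp : z - b \in cplxv Wp.
  by rewrite zE' -Lplus_cplxv memv_add.
have zm : z - b \in cplxv Wm.
  by rewrite -Lminus_cplxv addrC memv_add ?memvN.
have zb : z = b.
  have : z - b \in (0 : {vspace _})%VS by rewrite -cplxv_cap0 memv_cap zp.
  by rewrite memv0 => /eqP zb0; rewrite -[z](subrK b) zb0 add0r.
rewrite -(ieig_conjv0 Jgc) memv_cap.
rewrite ieig_J_split conjvD {1}zb (subvP (addvSr _ _) _ bL).
by rewrite (subvP (addvSr _ _) _ zL).
Qed.

(** The Dirac conditions hold because the two sums are the i-eigenspaces of J
    and J'. *)
Lemma gh_defined_by_Lpm : gh_defined_by (gh_Lplus S) (gh_Lminus S) S.
Proof.
split.
- split; last exact: gh_directv.
  by rewrite -addvA -conjvD -ieig_J_split (ieig_full Jgc).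
- rewrite -ieig_J_split -ieig_J'_split.
  by split; [exact: dirac_ieig | exact/dirac_ieig/gh_J'_complex].
- by rewrite Lplus_cplxv Lminus_cplxv.
- by rewrite ieig_J_split ieig_J'_split.
Qed.
End HermitianEigenspaces.

(** * Generalized Hermitian structures from bi-Hermitian data *)

Section GraphPairing.
Variables (R : realType) (V : vectType R) (gamma psi : 'Hom(V, dual V)).
Hypotheses (gamma_euclidean : euclidean gamma) (psi_skew : form_skew psi).
Local Notation tp := (tau (psi + gamma)).
Local Notation tm := (tau (psi - gamma)).

Lemma gpair_tau_plus X Y : gpair (tp X) (tp Y) = gamma X Y.
Proof.
rewrite /gpair !tauE /= !add_lfunE (psi_skew Y X).
have [-> _] := gamma_euclidean; set a := gamma Y X; set b := psi X Y; lra.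
Qed.

Lemma gpair_tau_minus X Y : gpair (tm X) (tm Y) = - gamma X Y.
Proof.
rewrite /gpair !tauE /= !(add_lfunE, opp_lfunE) (psi_skew Y X).
have [-> _] := gamma_euclidean; set a := gamma Y X; set b := psi X Y; lra.
Qed.

Lemma gpair_tau_mixed X Y : gpair (tp X) (tm Y) = 0.
Proof.
rewrite /gpair !tauE /= !(add_lfunE, opp_lfunE) (psi_skew Y X).
have [-> _] := gamma_euclidean; set a := gamma Y X; set b := psi X Y; lra.
Qed.
End GraphPairing.

Section Construction.
Variables (R : realType) (V : vectType R) (gamma psi : 'Hom(V, dual V)).
Hypotheses (gamma_euclidean : euclidean gamma) (psi_skew : form_skew psi).
Local Notation tp := (tau (psi + gamma)).
Local Notation tm := (tau (psi - gamma)).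

Lemma euclidean_ker0 : lker gamma == 0%VS.
Proof.
rewrite -subv0; apply/subvP=> X; rewrite memv_ker memv0 => /eqP gX.
apply: contraT => /(gamma_euclidean.2 X); rewrite gX lfunE ltxx //.
Qed.

Lemma euclidean_invK xi : gamma (gamma^-1%VF xi) = xi.
Proof.
apply: limg_lfunVK; suff -> : limg gamma = fullv by exact: memvf.
apply/eqP; rewrite eqEdim subvf limg_dim_eq; last first.
  by rewrite (eqP euclidean_ker0) capv0.
rewrite !dimvf -[dim (dual V)]/(dim V * 1)%N muln1; exact: leqnn.
Qed.

(** The solution (A, B) of x = tau_+ A + tau_- B: one has A + B = x.1 and
    gamma (A - B) = x.2 - psi x.1. *)
Definition plus_coord : 'Hom(bold V, V) :=
  2^-1 *: (fst_lfun + (gamma^-1 \o (snd_lfun - (psi \o fst_lfun)%VF))%VF).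
Definition minus_coord : 'Hom(bold V, V) :=
  2^-1 *: (fst_lfun - (gamma^-1 \o (snd_lfun - (psi \o fst_lfun)%VF))%VF).

Lemma plus_coordE x :
  plus_coord x = 2^-1 *: (x.1 + gamma^-1%VF (x.2 - psi x.1)).
Proof. by rewrite add_comp_diffE fst_lfunE snd_lfunE. Qed.

Lemma minus_coordE x :
  minus_coord x = 2^-1 *: (x.1 - gamma^-1%VF (x.2 - psi x.1)).
Proof. by rewrite sub_comp_diffE fst_lfunE snd_lfunE. Qed.

Lemma plus_coord_tp X : plus_coord (tp X) = X.
Proof.
rewrite plus_coordE tauE /= add_lfunE (addrC (psi X)) addrK.
by rewrite (lker0_lfunK euclidean_ker0) half_double.
Qed.

Lemma plus_coord_tm X : plus_coord (tm X) = 0.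
Proof.
rewrite plus_coordE tauE /= add_lfunE opp_lfunE (addrC (psi X)) addrK linearN /=.
by rewrite (lker0_lfunK euclidean_ker0) subrr scaler0.
Qed.

Lemma minus_coord_tp X : minus_coord (tp X) = 0.
Proof.
rewrite minus_coordE tauE /= add_lfunE (addrC (psi X)) addrK.
by rewrite (lker0_lfunK euclidean_ker0) subrr scaler0.
Qed.

Lemma minus_coord_tm X : minus_coord (tm X) = X.
Proof.
rewrite minus_coordE tauE /= add_lfunE opp_lfunE (addrC (psi X)) addrK linearN /=.
by rewrite (lker0_lfunK euclidean_ker0) opprK half_double.
Qed.

Lemma coord_split x : x = tp (plus_coord x) + tm (minus_coord x).
Proof.
set A := plus_coord x; set B := minus_coord x.
have AB1 : A + B = x.1.
  rewrite /A /B plus_coordE minus_coordE -scalerDr addrACA subrr addr0.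
  exact: half_double.
have AB2 : A - B = gamma^-1%VF (x.2 - psi x.1).
  rewrite /A /B plus_coordE minus_coordE -scalerBr opprB addrC addrA subrK.
  exact: half_double.
rewrite !tauE [LHS]surjective_pairing; congr (_, _); first by rewrite /= AB1.
rewrite /= !add_lfunE opp_lfunE addrACA -linearD -linearB /= AB1 AB2.
by rewrite euclidean_invK addrC subrK.
Qed.

Definition graph_metric : 'Hom(bold V, dual (bold V)) :=
  2 *: ((dual_lfun plus_coord \o gamma \o plus_coord)
        + (dual_lfun minus_coord \o gamma \o minus_coord))%VF.

Lemma graph_metricE x y : graph_metric x y =
  2 * (gamma (plus_coord x) (plus_coord y)
       + gamma (minus_coord x) (minus_coord y)).
Proof. exact: pullback_forms_sumE. Qed.

(** In the coordinates (A, B) the pairing is gamma on A minus gamma on B; the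
    axioms of a generalized metric are read off from this formula. *)
Lemma gpair_coord x y : gpair x y =
  gamma (plus_coord x) (plus_coord y) - gamma (minus_coord x) (minus_coord y).
Proof.
rewrite {1}[x]coord_split {1}[y]coord_split gpairDl !gpairDr.
rewrite (gpairC (tm (minus_coord x)) (tp (plus_coord y))).
rewrite !gpair_tau_mixed // gpair_tau_plus // gpair_tau_minus //.
by rewrite addr0 add0r.
Qed.

Lemma mem_tp x : (x \in limg tp) = (minus_coord x == 0).
Proof.
apply/memv_imgP/eqP => [[X _ ->]|x0]; first exact: minus_coord_tp.
exists (plus_coord x); first exact: memvf.
by rewrite {1}[x]coord_split x0 linear0 addr0.
Qed.

Lemma mem_tm x : (x \in limg tm) = (plus_coord x == 0).
Proof.
apply/memv_imgP/eqP => [[X _ ->]|x0]; first exact: plus_coord_tm.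
exists (minus_coord x); first exact: memvf.
by rewrite {1}[x]coord_split x0 linear0 add0r.
Qed.

Lemma coord_eq0 x : plus_coord x = 0 -> minus_coord x = 0 -> x = 0.
Proof. by move=> p0 m0; rewrite [x]coord_split p0 m0 !linear0 addr0. Qed.

Let gamma_pos X : X != 0 -> 0 < gamma X X. Proof. exact: gamma_euclidean.2. Qed.
Let gamma_ge0 X : 0 <= gamma X X.
Proof.
by have [->|/gamma_pos/ltW //] := eqVneq X 0; rewrite linear0.
Qed.
Let gamma0l Y : gamma 0 Y = 0. Proof. by rewrite linear0 lfunE. Qed.

Lemma graph_metric_euclidean : euclidean graph_metric.
Proof.
have [gs _] := gamma_euclidean; split=> [x y|x x0].
  by rewrite !graph_metricE; congr (_ * (_ + _)); apply: gs.
rewrite graph_metricE mulr_gt0 ?ltr0n //.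
have [p0|/gamma_pos p0] := eqVneq (plus_coord x) 0; last exact: ltr_wpDr.
have [m0|/gamma_pos m0] := eqVneq (minus_coord x) 0; last exact: ltr_wpDl.
by rewrite (coord_eq0 p0 m0) eqxx in x0.
Qed.

Lemma graph_full : (limg tp + limg tm)%VS = fullv.
Proof.
apply/eqP; rewrite eqEsubv subvf; apply/subvP=> x _; rewrite [x]coord_split.
by apply: memv_add; apply: memv_img; apply: memvf.
Qed.

Lemma graph_direct : directv (limg tp + limg tm).
Proof.
apply/directv_addP/eqP; rewrite -subv0; apply/subvP=> x.
rewrite memv_cap memv0 mem_tp mem_tm => /andP[/eqP m0 /eqP p0].
exact/eqP/coord_eq0.
Qed.

(** A positive subspace containing the graph contains, with x, its component
    in the other graph, where the pairing is negative. *)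
Lemma graph_max_pos : maximal_vs (@g_positive R V) (limg tp).
Proof.
split=> [x|U Upos pU].
  rewrite mem_tp => /eqP m0 x0; rewrite gpair_coord m0 gamma0l subr0.
  by apply: gamma_pos; apply: contraNneq x0 => p0; rewrite (coord_eq0 p0 m0).
apply/eqP; rewrite eqEsubv pU andbT; apply/subvP=> x xU.
rewrite mem_tp; apply: contraT => m0.
have mU : tm (minus_coord x) \in U.
  have -> : tm (minus_coord x) = x - tp (plus_coord x).
    by rewrite {2}[x]coord_split addrAC subrr add0r.
  by rewrite memvB // (subvP pU) // memv_img // memvf.
have /(Upos _ mU) : tm (minus_coord x) != 0.
  by apply: contraNneq m0 => t0; rewrite -[minus_coord x]minus_coord_tm t0 linear0.
by rewrite gpair_tau_minus // oppr_gt0 ltNge gamma_ge0.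
Qed.

Lemma graph_max_neg : maximal_vs (@g_negative R V) (limg tm).
Proof.
split=> [x|U Uneg mU].
  rewrite mem_tm => /eqP p0 x0; rewrite gpair_coord p0 gamma0l sub0r oppr_lt0.
  by apply: gamma_pos; apply: contraNneq x0 => m0; rewrite (coord_eq0 p0 m0).
apply/eqP; rewrite eqEsubv mU andbT; apply/subvP=> x xU.
rewrite mem_tm; apply: contraT => p0.
have pU : tp (plus_coord x) \in U.
  have -> : tp (plus_coord x) = x - tm (minus_coord x).
    by rewrite {2}[x]coord_split addrK.
  by rewrite memvB // (subvP mU) // memv_img // memvf.
have /(Uneg _ pU) : tp (plus_coord x) != 0.
  by apply: contraNneq p0 => t0; rewrite -[plus_coord x]plus_coord_tp t0 linear0.
by rewrite gpair_tau_plus // ltNge gamma_ge0.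
Qed.

Lemma graph_g_orth : {in limg tp & limg tm, forall x y, gpair x y = 0}.
Proof.
by move=> x y /memv_imgP[X _ ->] /memv_imgP[Y _ ->]; apply: gpair_tau_mixed.
Qed.

Lemma graph_G_orth : {in limg tp & limg tm, forall x y, graph_metric x y = 0}.
Proof.
move=> x y; rewrite mem_tp mem_tm graph_metricE => /eqP-> /eqP->.
by rewrite gamma0l linear0 addr0 mulr0.
Qed.

Lemma graph_G_plus :
  {in limg tp &, forall x y, graph_metric x y = 2 * gpair x y}.
Proof.
move=> x y; rewrite !mem_tp graph_metricE gpair_coord => /eqP-> /eqP->.
by rewrite gamma0l addr0 subr0.
Qed.

Lemma graph_G_minus :
  {in limg tm &, forall x y, graph_metric x y = - (2 * gpair x y)}.
Proof.
move=> x y; rewrite !mem_tm graph_metricE gpair_coord => /eqP-> /eqP->.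
by rewrite gamma0l add0r sub0r mulrN opprK.
Qed.

Definition graph_gen_metric : gen_metric V :=
  GenMetric graph_metric_euclidean graph_full graph_direct graph_max_pos
    graph_max_neg graph_g_orth graph_G_orth graph_G_plus graph_G_minus.

Variables Jp Jm : 'End(V).
Hypotheses (JpK : forall X, Jp (Jp X) = - X) (JmK : forall X, Jm (Jm X) = - X).
Hypotheses (Jp_skew : forall X Y, gamma (Jp X) Y = - gamma X (Jp Y))
  (Jm_skew : forall X Y, gamma (Jm X) Y = - gamma X (Jm Y)).

Definition graph_J : 'End(bold V) :=
  (tp \o Jp \o plus_coord)%VF + (tm \o Jm \o minus_coord)%VF.

Lemma graph_JE x :
  graph_J x = tp (Jp (plus_coord x)) + tm (Jm (minus_coord x)).
Proof. by rewrite add_lfunE !comp_lfunE. Qed.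

Lemma graph_J_tp X : graph_J (tp X) = tp (Jp X).
Proof. by rewrite graph_JE plus_coord_tp minus_coord_tp !linear0 addr0. Qed.

Lemma graph_J_tm X : graph_J (tm X) = tm (Jm X).
Proof. by rewrite graph_JE plus_coord_tm minus_coord_tm !linear0 add0r. Qed.

Lemma plus_coord_J x : plus_coord (graph_J x) = Jp (plus_coord x).
Proof. by rewrite graph_JE linearD /= plus_coord_tp plus_coord_tm addr0. Qed.

Lemma minus_coord_J x : minus_coord (graph_J x) = Jm (minus_coord x).
Proof. by rewrite graph_JE linearD /= minus_coord_tp minus_coord_tm add0r. Qed.

Lemma graph_J_complex : gen_complex graph_J.
Proof.
split=> [|x y].
  apply/sqr_oppE => x; rewrite [LHS]graph_JE.
  rewrite plus_coord_J minus_coord_J JpK JmK !linearN /= -opprD.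
  by rewrite -coord_split.
rewrite !gpair_coord !plus_coord_J !minus_coord_J Jp_skew Jm_skew.
by rewrite opprK opprB addrC.
Qed.

Lemma graph_J_comm :
  (graph_J \o gm_H graph_gen_metric = gm_H graph_gen_metric \o graph_J)%VF.
Proof.
have Hp X : gm_H graph_gen_metric (tp X) = tp X.
  by apply: gm_Hplus; apply/memv_img/memvf.
have Hm X : gm_H graph_gen_metric (tm X) = - tm X.
  by apply: gm_Hminus; apply/memv_img/memvf.
(* The involution and the operator are only known through their values on the
   two graphs from here on. *)
move: (gm_H graph_gen_metric) (graph_J) graph_J_tp graph_J_tm Hp Hm.
move=> H J JtpE JtmE Hp Hm; apply/lfunP=> x; rewrite !comp_lfunE.
rewrite (coord_split x); move: (plus_coord x) (minus_coord x) => X Y.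
by rewrite !linearD /= Hp Hm linearN /= JtpE JtmE Hp Hm.
Qed.

Definition graph_gen_hermitian : gen_hermitian V :=
  GenHermitian graph_J_complex graph_J_comm.
End Construction.

(** * Pullbacks *)

Section PullbackProperties.
Variables (R : realType) (V W : vectType R) (f : 'Hom(V, W)).
Implicit Types U : {vspace cvec (bold W)}.

Lemma gpair_pull (X Y : V) (eta mu : dual W) :
  gpair ((X, eta \o f)%VF : bold V) (Y, mu \o f)%VF
    = gpair ((f X, eta) : bold W) (f Y, mu).
Proof. by rewrite /gpair /= !comp_lfunE. Qed.

Lemma pullback_isotropic U : isotropic U -> isotropic (pullback f U).
Proof.
move=> Uiso x y /mem_pullback[X [eta [-> xU]]] /mem_pullback[Y [mu [-> yU]]].
by rewrite -[RHS](Uiso _ _ xU yU) /cgpair !gpair_pull.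
Qed.

Lemma pullbackS U U' : (U <= U')%VS -> (pullback f U <= pullback f U')%VS.
Proof. by move=> UU'; apply/limgS/lpreimS. Qed.

(** The map f is real, so the witnesses of a pullback can be conjugated. *)
Lemma conjv_pullback_sub U : (conjv (pullback f U) <= pullback f (conjv U))%VS.
Proof.
apply/subvP=> z; rewrite memv_conj => /mem_pullback[X [eta [zE hU]]].
apply/mem_pullback; exists (cconj X), (cconj eta); split; last first.
  rewrite memv_conj /cconj /= (_ : - _ = (f X.2, eta.2)) //.
  by rewrite [LHS]surjective_pairing /= linearN !opprK.
rewrite -[z]cconjK zE; apply: cvec_eq => //=.
rewrite [LHS]surjective_pairing /=; congr (_, _); apply/lfunP=> w.
by rewrite comp_lfunE !opp_lfunE comp_lfunE.
Qed.

Definition restrict_form (theta : 'Hom(W, dual W)) : 'Hom(V, dual V) :=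
  (dual_lfun f \o theta \o f)%VF.

Lemma restrict_formE theta X Y : restrict_form theta X Y = theta (f X) (f Y).
Proof. by rewrite !comp_lfunE dual_lfunE. Qed.

Lemma restrict_form_comp theta X : restrict_form theta X = (theta (f X) \o f)%VF.
Proof. by apply/lfunP=> Y; rewrite restrict_formE comp_lfunE. Qed.

(** U is the i-eigenspace of J inside the complexified
    graph of theta, where J acts as j on the base.  A vector (X, eta) + i (Y, mu)
    whose image is in U has eta = theta (f X), and f Y = - j (f X) = f (- jV X),
    so injectivity of f gives Y = - jV X: these are the vectors of the
    i-eigenspace over V, for the restricted form. *)
Lemma pullback_graph_eigenspace (theta : 'Hom(W, dual W)) (J : 'End(bold W))
    (j : 'End(W)) (thetaV : 'Hom(V, dual V)) (JV : 'End(bold V)) (jV : 'End(V))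
    U (UV : {vspace cvec (bold V)}) :
  injective f -> thetaV = restrict_form theta ->
  (forall X, f (jV X) = j (f X)) ->
  (forall X, J (tau theta X) = tau theta (j X)) ->
  (forall X, JV (tau thetaV X) = tau thetaV (jV X)) ->
  (forall z, (z \in U) = (z.1 \in limg (tau theta)) && (z.2 == - J z.1)) ->
  (forall z, (z \in UV) = (z.1 \in limg (tau thetaV)) && (z.2 == - JV z.1)) ->
  pullback f U = UV.
Proof.
move=> f_inj -> fj Jt JVt UE UVE; apply/vspaceP=> z.
have tauC X : tau (restrict_form theta) X = (X, (theta (f X) \o f)%VF).
  by rewrite tauE restrict_form_comp.
apply/idP/idP => [/mem_pullback[X [eta [-> ]]]|].
  rewrite UE mem_graph /= => /andP[/eqP eta1]; rewrite eta1.
  rewrite -[(f X.1, theta (f X.1))]tauE Jt -linearN /=.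
  rewrite tauE /= -fj -linearN /= => /eqP[/f_inj X2 eta2].
  rewrite UVE /= -tauC memv_img ?memvf //= JVt -linearN /= tauC X2 /= eta2.
  by rewrite linearN.
rewrite UVE => /andP[/memv_imgP[X _ z1]]; rewrite z1 JVt -linearN /= => /eqP z2.
apply/mem_pullback; exists (X, - jV X), (theta (f X), theta (f (- jV X))).
split; first by apply: cvec_eq; rewrite /= -tauC.
rewrite UE /= -!tauE memv_img ?memvf //= Jt.
by rewrite -fj !linearN.
Qed.
End PullbackProperties.

(** * The complex structures on the base *)

Section BicomplexStructures.
Variables (R : realType) (W : vectType R) (S : gen_hermitian W).
Variables (gamma psi : 'Hom(W, dual W)).
Hypothesis pairS : gm_pair S gamma psi.
Local Notation Jp := (gh_Jplus S gamma psi).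
Local Notation Jm := (gh_Jminus S gamma psi).
Local Notation tp := (tau (psi + gamma)).
Local Notation tm := (tau (psi - gamma)).

Lemma graph_stableE (theta : 'Hom(W, dual W)) (J : 'End(bold W)) X :
  J (tau theta X) \in limg (tau theta) ->
  J (tau theta X) = tau theta ((fst_lfun \o J \o tau theta)%VF X).
Proof.
rewrite mem_graph => /eqP J2.
by rewrite [RHS]tauE !comp_lfunE fst_lfunE -J2 -surjective_pairing.
Qed.

Lemma gh_J_tp X : gh_J S (tp X) = tp (Jp X).
Proof.
case: pairS => _ _ pE _; apply: graph_stableE.
by rewrite -pE gh_J_plus // pE memv_img // memvf.
Qed.

Lemma gh_J_tm X : gh_J S (tm X) = tm (Jm X).
Proof.
case: pairS => _ _ _ mE; apply: graph_stableE.
by rewrite -mE gh_J_minus // mE memv_img // memvf.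
Qed.

Lemma tau_inj (theta : 'Hom(W, dual W)) : injective (tau theta).
Proof. by move=> X Y; rewrite !tauE => -[]. Qed.

Lemma gh_JplusK X : Jp (Jp X) = - X.
Proof.
apply: (@tau_inj (psi + gamma)).
by rewrite -!gh_J_tp (gen_complexK (gh_complex S)) linearN.
Qed.

Lemma gh_JminusK X : Jm (Jm X) = - X.
Proof.
apply: (@tau_inj (psi - gamma)).
by rewrite -!gh_J_tm (gen_complexK (gh_complex S)) linearN.
Qed.

Lemma gh_Jplus_skew X Y : gamma (Jp X) Y = - gamma X (Jp Y).
Proof.
case: pairS => ge ps _ _; rewrite -!(gpair_tau_plus ge ps) -!gh_J_tp.
exact: gen_complex_skew (gh_complex S) _ _.
Qed.

Lemma gh_Jminus_skew X Y : gamma (Jm X) Y = - gamma X (Jm Y).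
Proof.
case: pairS => ge ps _ _; apply: oppr_inj.
rewrite -!(gpair_tau_minus ge ps) -!gh_J_tm.
by rewrite (gen_complex_skew (gh_complex S)).
Qed.
End BicomplexStructures.

(** * The induced structures *)

Section Induced.
Variables (R : realType) (W : vectType R) (S : gen_hermitian W).
Variables (gamma psi : 'Hom(W, dual W)) (V : {vspace W}).
Hypotheses (pairS : gm_pair S gamma psi) (bicV : bicomplex V S gamma psi).
Local Notation i := (incl V).

Lemma inclE (X : subvs_of V) : i X = vsval X.
Proof. by rewrite lfunE. Qed.

Lemma incl_inj : injective i.
Proof. by move=> X Y; rewrite !inclE => /val_inj. Qed.

(** The projection onto V has no effect when j preserves V; it makes the
    restriction total. *)
Definition restrict_end (j : 'End(W)) : 'End(subvs_of V) :=
  (linfun (vsproj V) \o j \o i)%VF.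

Lemma restrict_endE (j : 'End(W)) : (j @: V)%VS = V ->
  forall X, i (restrict_end j X) = j (i X).
Proof.
move=> jV X; rewrite !comp_lfunE inclE lfunE /= vsprojK //.
by have := memv_img j (subvsP X); rewrite jV inclE.
Qed.

Lemma restrict_end_opp (j : 'End(W)) : (j @: V)%VS = V ->
  (forall X, j (j X) = - X) ->
  forall X, restrict_end j (restrict_end j X) = - X.
Proof.
by move=> jV jK X; apply: incl_inj; rewrite !restrict_endE // jK linearN.
Qed.

Lemma restrict_end_skew (j : 'End(W)) : (j @: V)%VS = V ->
  (forall X Y, gamma (j X) Y = - gamma X (j Y)) ->
  forall X Y, restrict_form i gamma (restrict_end j X) Y =
    - restrict_form i gamma X (restrict_end j Y).
Proof. by move=> jV js X Y; rewrite !restrict_formE !restrict_endE. Qed.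

Lemma restrict_euclidean : euclidean (restrict_form i gamma).
Proof.
case: pairS => -[gs gp] _ _ _; split=> [X Y|X X0]; rewrite !restrict_formE //.
by apply: gp; apply: contraNneq X0 => iX0; apply/eqP/incl_inj; rewrite iX0 linear0.
Qed.

Lemma restrict_skew : form_skew (restrict_form i psi).
Proof. by case: pairS => _ ps _ _ X Y; rewrite !restrict_formE. Qed.

Lemma restrict_formD (s t : 'Hom(W, dual W)) :
  restrict_form i s + restrict_form i t = restrict_form i (s + t).
Proof.
by apply/lfunP=> X; apply/lfunP=> Y;
  rewrite !add_lfunE !restrict_formE !add_lfunE.
Qed.

Lemma restrict_formB (s t : 'Hom(W, dual W)) :
  restrict_form i s - restrict_form i t = restrict_form i (s - t).
Proof.
by apply/lfunP=> X; apply/lfunP=> Y;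
  rewrite !(add_lfunE, opp_lfunE) !restrict_formE !(add_lfunE, opp_lfunE).
Qed.

Definition induced_hermitian : gen_hermitian (subvs_of V) :=
  graph_gen_hermitian restrict_euclidean restrict_skew
    (restrict_end_opp bicV.1 (gh_JplusK pairS))
    (restrict_end_opp bicV.2 (gh_JminusK pairS))
    (restrict_end_skew bicV.1 (gh_Jplus_skew pairS))
    (restrict_end_skew bicV.2 (gh_Jminus_skew pairS)).

Lemma pullback_Lplus : pullback i (gh_Lplus S) = gh_Lplus induced_hermitian.
Proof.
case: (pairS) => _ _ pE _.
apply: (pullback_graph_eigenspace (JV := gh_J induced_hermitian) incl_inj (restrict_formD psi gamma)
  (restrict_endE bicV.1) (gh_J_tp pairS)) => [X|z|z].
- by apply: graph_J_tp; apply: restrict_euclidean.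
- by rewrite mem_gh_Lplus pE.
- by rewrite mem_gh_Lplus.
Qed.

Lemma pullback_Lminus : pullback i (gh_Lminus S) = gh_Lminus induced_hermitian.
Proof.
case: (pairS) => _ _ _ mE.
apply: (pullback_graph_eigenspace (JV := gh_J induced_hermitian) incl_inj (restrict_formB psi gamma)
  (restrict_endE bicV.2) (gh_J_tm pairS)) => [X|z|z].
- by apply: graph_J_tm; apply: restrict_euclidean.
- by rewrite mem_gh_Lminus mE.
- by rewrite mem_gh_Lminus.
Qed.

Lemma gh_induced_hermitian : gh_induced V S induced_hermitian.
Proof. by rewrite /gh_induced pullback_Lplus pullback_Lminus; apply: gh_defined_by_Lpm. Qed.
End Induced.

(** Any structure T induced by L_+ and L_- carries the structures induced by J
    and J': the pullback of an i-eigenspace of W is isotropic and contains the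
    corresponding i-eigenspace of T, which is maximal isotropic. *)
Lemma gh_induced_gc (R : realType) (W : vectType R) (S : gen_hermitian W)
    (V : {vspace W}) (T : gen_hermitian (subvs_of V)) :
  gh_induced V S T ->
  gc_induced V (gh_J S) (gh_J T) /\ gc_induced V (gh_J' S) (gh_J' T).
Proof.
case=> _ [LD L'D] _ [JE J'E]; split; split.
- exact: gh_complex.
- rewrite JE; apply/esym/(LD.2 _ (pullback_isotropic (ieig_isotropic (gh_complex S)))).
  by rewrite ieig_J_split subv_add !pullbackS ?addvSl ?addvSr.
- exact: gh_J'_complex.
- rewrite J'E; apply/esym/(L'D.2 _ (pullback_isotropic (ieig_isotropic (gh_J'_complex S)))).
  rewrite ieig_J'_split subv_add pullbackS ?addvSl //=.
  exact: subv_trans (conjv_pullback_sub _ _) (pullbackS _ (addvSr _ _)).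
Qed.

Lemma gc_induced_inj (R : realType) (W : vectType R) (V : {vspace W})
    (J : 'End(bold W)) (Jt Jt' : 'End(bold (subvs_of V))) :
  gc_induced V J Jt -> gc_induced V J Jt' -> Jt = Jt'.
Proof. by move=> [gJ eJ] [gJ' eJ']; exact: ieig_inj gJ gJ' (etrans eJ (esym eJ')). Qed.

Theorem proposition4p3 (R : realType) (W : vectType R) (S : gen_hermitian W)
    (gamma psi : 'Hom(W, dual W)) (V : {vspace W}) :
  gm_pair S gamma psi -> bicomplex V S gamma psi ->
  [/\ gc_subspace V (gh_J S), gc_subspace V (gh_J' S),
      (exists T : gen_hermitian (subvs_of V), gh_induced V S T) &
      forall (Jt Jt' : 'End(bold (subvs_of V))) (T : gen_hermitian (subvs_of V)),
        gc_induced V (gh_J S) Jt -> gc_induced V (gh_J' S) Jt' ->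
        gh_induced V S T ->
        Jt = gh_J T /\ Jt' = gh_J' T].
Proof.
move=> pairS bicV; have indT := gh_induced_hermitian pairS bicV.
have [indJ indJ'] := gh_induced_gc indT; split.
- by eexists; exact: indJ.
- by eexists; exact: indJ'.
- by eexists; exact: indT.
move=> Jt Jt' T' iJ iJ' /gh_induced_gc[iJT iJT'].
by split; [exact: gc_induced_inj iJ iJT | exact: gc_induced_inj iJ' iJT'].
Qed.
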